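(* Let $\frac{\alpha}{\beta}=[a_1,a_2,\ldots,a_{2n}]=[e_1,2e_2,\ldots,e_{2n-1},2e_{2n}]$, with $e_i=\pm1$, be a continued fraction in which there are no three consecutive sign changes and such that $e_1=e_2$. Let $\sigma$ denote its number of islets. Then $$\mathrm{cn}\Big(\frac{\alpha}{\beta}\Big)=\sum_{i=1}^{2n}|a_i|-\#\{i:\ a_ia_{i+1}<0\}-2\sigma .$$
   Context: For integers $a_1,\dots,a_m$, $[a_1,\ldots,a_m]$ denotes the continued fraction $a_1+\cfrac{1}{a_2+\cfrac{1}{\cdots+\cfrac{1}{a_m}}}$; it is required to be well defined, i.e. all the tails $[a_k,\ldots,a_m]$ with $2\le k\le m$ are finite and nonzero. ''No three consecutive sign changes'' means that there is no $i$ with $a_ia_{i+1}<0$, $a_{i+1}a_{i+2}<0$ and $a_{i+2}a_{i+3}<0$. An index $i$ is an islet in $[a_1,\ldots,a_m]$ when $|a_i|=1$ and $a_{i-1}=a_{i+1}=-2a_i$. Crossing number of a rational number: if $r>0$ is written $r=[q_1,\ldots,q_k]$ with all $q_i$ positive integers, then $\mathrm{cn}(r)=q_1+\cdots+q_k$ (this does not depend on the choice of such an expansion); moreover $\mathrm{cn}(-r)=\mathrm{cn}(r)$. *)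

(* Defs.v *)
From mathcomp Require Import all_boot all_order all_algebra.
From mathcomp Require Import boolp classical_sets.
From mathcomp Require Import zify lra.
Set Implicit Arguments.
Unset Strict Implicit.
Unset Printing Implicit Defensive.
Import Order.TTheory GRing.Theory Num.Theory.
Local Open Scope ring_scope.

(* [a_1, ..., a_m] in [rat].  Since [0^-1 = 0], the base case gives [[a] = a];
   the value is meaningful only under [cfrac_defined]. *)
Fixpoint cfrac (s : seq int) : rat :=
  if s is a :: t then a%:~R + (cfrac t)^-1 else 0.

(* No tail [a_k, ..., a_m] with 2 <= k <= m vanishes; going from the last tail
   backwards, this is also what makes each of them finite. *)
Definition cfrac_defined (s : seq int) : Prop :=
  forall k, (0 < k < size s)%N -> cfrac (drop k s) != 0.

(* Indices are those of [seq], hence start at 0. *)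
Definition sign_change (s : seq int) (i : nat) : bool :=
  (i.+1 < size s)%N && (s`_i * s`_i.+1 < 0).

Definition no_three_sign_changes (s : seq int) : Prop :=
  ~ exists i, [/\ sign_change s i, sign_change s i.+1 & sign_change s i.+2].

Definition islet (s : seq int) (i : nat) : bool :=
  [&& (0 < i)%N, (i.+1 < size s)%N, `|s`_i| == 1,
      s`_i.-1 == - 2 * s`_i & s`_i.+1 == - 2 * s`_i].

Definition positive_expansion (r : rat) (q : seq nat) : Prop :=
  [/\ q != [::], all (fun x => 0 < x)%N q & r = cfrac (map Posz q)].

(* The common value of [sumn q] over the positive expansions [q] of [`|r|]
   (see [crossing_number_cfrac]), and 0 if there is none, i.e. if [`|r| < 1]. *)
Definition crossing_number (r : rat) : nat :=
  xget 0%N [set c | exists2 q, positive_expansion `|r| q & c = sumn q]%classic.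

Lemma posz_ge1 (x : nat) : (0 < x)%N -> 1 <= (Posz x)%:~R :> rat.
Proof. by case: x => // x _; rewrite -[1]/(1%:~R) ler_int. Qed.

Lemma cfrac_ge1 (q : seq nat) :
  q != [::] -> all (fun x => 0 < x)%N q -> 1 <= cfrac (map Posz q).
Proof.
elim: q => // x [|y t] IH _ /andP[x0 pt]; rewrite [map _ _]/= [cfrac _]/=.
  by rewrite invr0 addr0; exact: posz_ge1.
have h := IH isT pt; rewrite -[1]addr0 lerD ?posz_ge1 //.
by rewrite invr_ge0; exact: le_trans h.
Qed.

Lemma cfrac_le1 (q : seq nat) :
  q != [::] -> all (fun x => 0 < x)%N q -> cfrac (map Posz q) <= 1 ->
  q = [:: 1%N].
Proof.
case: q => // x [|y t] _ /andP[x0 pt]; rewrite [map _ _]/= [cfrac _]/=.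
  by rewrite invr0 addr0 -[1]/(1%:~R) ler_int => h; congr [:: _]; lia.
have h := @cfrac_ge1 (y :: t) isT pt.
have hi : 0 < (cfrac (map Posz (y :: t)))^-1.
  by rewrite invr_gt0; exact: lt_le_trans h.
have hx : (1 : rat) <= (Posz x)%:~R by exact: posz_ge1.
move: hi; rewrite [map _ _]/= => hi hle.
by exfalso; lra.
Qed.

Lemma sumn_positive_expansion (r : rat) (q q' : seq nat) :
  positive_expansion r q -> positive_expansion r q' -> sumn q = sumn q'.
Proof.
(* integral part: [x + 1/t = y + 1/u] with [1 < t] and [1 <= u] *)
have key (x y : nat) (a b : rat) : 0 <= a < 1 -> 0 <= b <= 1 ->
    (Posz x)%:~R + a = (Posz y)%:~R + b ->
    (x = y /\ a = b) \/ [/\ x = y.+1, a = 0 & b = 1].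
  move=> /andP[a0 a1] /andP[b0 b1] e.
  have h1 : ((Posz y)%:~R : rat) < (Posz x + 1)%:~R by rewrite intrD; lra.
  have h2 : ((Posz x)%:~R : rat) <= (Posz y + 1)%:~R by rewrite intrD; lra.
  move: h1 h2; rewrite ltr_int ler_int => h1 h2.
  have [xy|xy] : x = y \/ x = y.+1 by lia.
    by left; split=> //; subst y; lra.
  right; split=> //; move: e; rewrite xy -addn1 PoszD intrD; lra.
have inv01 t : t != [::] -> all (fun x => 0 < x)%N t ->
    0 < (cfrac (map Posz t))^-1 <= 1.
  move=> t0 pt; have h := cfrac_ge1 t0 pt.
  by rewrite invr_gt0 (lt_le_trans _ h) //= invf_le1 ?(lt_le_trans _ h).
have inv1 t : t != [::] -> all (fun x => 0 < x)%N t ->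
    1 <= (cfrac (map Posz t))^-1 -> t = [:: 1%N].
  move=> t0 pt h; apply: cfrac_le1 => //.
  have h1 := cfrac_ge1 t0 pt; have p : 0 < cfrac (map Posz t) by lra.
  by rewrite -(invrK (cfrac _)) invf_le1 ?invr_gt0.
have inv01' t : all (fun x => 0 < x)%N t ->
    0 <= (cfrac (map Posz t))^-1 <= 1.
  case: t => [_|x t pt]; first by rewrite /= invr0.
  by have /andP[/ltW -> ->] := inv01 (x :: t) isT pt.
have step x y t u : all (fun x => 0 < x)%N t -> all (fun x => 0 < x)%N u ->
    t != [:: 1%N] ->
    (Posz x)%:~R + (cfrac (map Posz t))^-1 =
      (Posz y)%:~R + (cfrac (map Posz u))^-1 ->
    (x = y /\ cfrac (map Posz t) = cfrac (map Posz u))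
      \/ [/\ x = y.+1, t = [::] & u = [:: 1%N]].
  move=> pt pu t1 e; have /andP[ha hb] := inv01' t pt.
  have lt1 : 0 <= (cfrac (map Posz t))^-1 < 1.
    rewrite ha ltNge; apply/negP => h.
    case: t t1 pt h {e ha hb} => [|z t] t1 pt h; first by move: h; rewrite /= invr0.
    by move/eqP: t1; apply; exact: inv1.
  have [[-> /invr_inj ->]|[-> t0 u1]] := key _ _ _ _ lt1 (inv01' u pu) e.
    by left.
  right; split=> //; last first.
    apply: inv1 => //; last by rewrite u1.
    by apply/eqP => u0; move: u1; rewrite u0 /= invr0.
  case: t t0 pt {e ha hb t1 lt1} => // z t t0 pt.
  by have := inv01 (z :: t) isT pt; rewrite t0.
have nz z t : all (fun x => 0 < x)%N (z :: t) -> cfrac (map Posz (z :: t)) <> 0.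
  by move=> /(@cfrac_ge1 (z :: t) isT) h h0; rewrite h0 in h.
elim: q q' r => [|x t IH] [|y u] r [] // _ px -> [] // _ py.
have /andP[_ pt] := px; have /andP[_ pu] := py.
rewrite [map _ (x :: t)]/= [cfrac (_ :: map _ t)]/=.
rewrite [map _ (y :: u)]/= [cfrac (_ :: map _ u)]/= => e.
have rec : cfrac (map Posz t) = cfrac (map Posz u) -> sumn t = sumn u.
  case: t u IH pt pu {px py e} => [|z t] [|w u] IH pt pu e //.
  - by case: (nz w u).
  - by case: (nz z t).
  - by apply: (IH _ (cfrac (map Posz (z :: t)))).
have [t1|t1] := eqVneq t [:: 1%N]; have [u1|u1] := eqVneq u [:: 1%N].
- by move: e; rewrite t1 u1 => /addIr /eqP; rewrite eqr_int /= => /eqP [->].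
- have [[xy e']|[-> -> ->]] := step _ _ _ _ pu pt u1 (esym e).
    by rewrite /= xy rec.
  by rewrite /= !addn0 addn1.
- have [[-> e']|[-> -> ->]] := step _ _ _ _ pt pu t1 e.
    by rewrite /= rec.
  by rewrite /= !addn0 addn1.
- have [[-> e']|[-> -> ->]] := step _ _ _ _ pt pu t1 e.
    by rewrite /= rec.
  by rewrite /= !addn0 addn1.
Qed.

Lemma crossing_number_cfrac (q : seq nat) :
  q != [::] -> all (fun x => 0 < x)%N q ->
  crossing_number (cfrac (map Posz q)) = sumn q.
Proof.
move=> q0 pq; rewrite /crossing_number; case: xgetP => [c _ [q' hq' ->]|].
  apply: sumn_positive_expansion hq' _; split=> //.
  by rewrite ger0_norm // (le_trans _ (cfrac_ge1 q0 pq)).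
move=> /(_ (sumn q)) []; exists q => //; split=> //.
by rewrite ger0_norm // (le_trans _ (cfrac_ge1 q0 pq)).
Qed.

Lemma crossing_numberN (r : rat) : crossing_number (- r) = crossing_number r.
Proof. by rewrite /crossing_number normrN. Qed.

(* Main.v *)
Require Import Defs.
From mathcomp Require Import all_boot all_order all_algebra.
From mathcomp Require Import zify ring lra.
Import Order.TTheory GRing.Theory Num.Theory.
Local Open Scope ring_scope.

(* Write [N] for the sum of the partial quotients of a positive rational, a zero
   first quotient being allowed; then [N (1 + r) = 1 + N r] and [N (1 / r) = N r].
   Up to a global sign the expansion starts with 1, and it is shortened from the
   left by the following rules, in which the last entry is plus or minus the value
   [y > 0] of a remaining tail:
     N [1, 2, y]        = 3 + N y,
     N [1, 2, -y]       = 2 + N y    if the tail is [1, 2, ...], so that y > 1,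
     N [1, 2, -1, 2, y] = 2 + N y    (an islet: the value is 2 + y),
     N [1, -2, -y]      = 2 + N y,
     N [1, -2, y]       = 1 + N y    if the tail is [1, 2, ...], so that y > 1.
   The sign conditions exclude all other beginnings, and the right-hand side of
   the formula satisfies the same rules. *)

(** * Sums of partial quotients of positive rationals *)

Inductive quotient_sum : rat -> nat -> Prop :=
| quotient_sum1 : quotient_sum 1 1
| quotient_sumD1 r c : quotient_sum r c -> quotient_sum (1 + r) c.+1
| quotient_sumV r c : quotient_sum r c -> quotient_sum r^-1 c.

Lemma quotient_sum_gt0 r c : quotient_sum r c -> 0 < r.
Proof. by elim=> // {}r {}c _ h; [lra | rewrite invr_gt0]. Qed.

(** Inversion exchanges the two claims, so they are proved together. For [1 + r], the first quotient
    of [r] is raised by one if [1 <= r]; otherwise a quotient 1 is put before an expansion of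
    [r^-1]. *)
Lemma quotient_sum_expansion r c : quotient_sum r c ->
  (1 <= r -> exists2 q, positive_expansion r q & c = sumn q) /\
  (r <= 1 -> exists2 q, positive_expansion r^-1 q & c = sumn q).
Proof.
elim=> [|{}r {}c hr [IH1 IH2]|{}r {}c hr [IH1 IH2]].
- by split=> _; exists [:: 1%N].
- have r0 := quotient_sum_gt0 _ _ hr; split=> [_|]; last lra.
  case: (lerP 1 r) => [/IH1|/ltW /IH2] [q [q0 pq rq] ->].
    case: q q0 pq rq => // x t _ /andP[x0 pt] ->.
    exists (x.+1 :: t) => //; split=> //.
    by rewrite /= -addn1 PoszD intrD; ring.
  by exists (1%N :: q) => //; split=> //=; rewrite -rq invrK.
- have r0 := quotient_sum_gt0 _ _ hr; rewrite invrK; split=> h.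
    by apply: IH2; rewrite -invf_ge1.
  by apply: IH1; rewrite -invf_le1.
Qed.

Lemma crossing_number_quotient_sum r c :
  1 <= r -> quotient_sum r c -> crossing_number r = c.
Proof.
move=> r1 /quotient_sum_expansion [/(_ r1) [q [q0 pq ->] ->] _].
exact: crossing_number_cfrac.
Qed.

(** * The right-hand side of the formula and the lists it is applied to *)

Definition reduced_length (s : seq int) : int :=
  \sum_(x <- s) `|x| - (count (sign_change s) (iota 0 (size s)))%:Z
  - 2 * (count (islet s) (iota 0 (size s)))%:Z.

(** A new head can create a sign change only at position 0, and an islet only at position 1, since
    an islet needs a left neighbour; all others are merely shifted. *)
Lemma reduced_length_cons x s :
  reduced_length (x :: s) = reduced_length s + `|x|
    - (sign_change (x :: s) 0)%:Z - 2 * (islet (x :: s) 1)%:Z.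
Proof.
rewrite /reduced_length big_cons [iota 0 _]/= !(iotaDl 1) [count _ (_ :: _)]/=.
rewrite [count (islet _) (_ :: _)]/= !count_map add0n.
rewrite (eq_count (a2 := sign_change s)) //.
have -> : count (preim (addn 1) (islet (x :: s))) (iota 0 (size s)) =
    (islet (x :: s) 1 + count (islet s) (iota 0 (size s)))%N.
  case: s => [|y s] //=; rewrite !(iotaDl 1) !count_map; congr (_ + _)%N.
by rewrite !PoszD; ring.
Qed.

Lemma nth_opp (s : seq int) i : (map -%R s)`_i = - s`_i.
Proof.
have [h|h] := ltnP i (size s); first exact: nth_map.
by rewrite !nth_default ?size_map ?oppr0.
Qed.

Lemma sign_change_opp s i : sign_change (map -%R s) i = sign_change s i.
Proof. by rewrite /sign_change size_map !nth_opp mulrNN. Qed.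

Lemma islet_opp s i : islet (map -%R s) i = islet s i.
Proof. by rewrite /islet size_map !nth_opp normrN !mulrN !eqr_opp. Qed.

Lemma reduced_length_opp s : reduced_length (map -%R s) = reduced_length s.
Proof.
rewrite /reduced_length big_map size_map (eq_count (sign_change_opp s)).
rewrite (eq_count (islet_opp s)); congr (_ - _ - _).
by apply: eq_bigr => x _; rewrite normrN.
Qed.

Lemma cfrac_opp s : cfrac (map -%R s) = - cfrac s.
Proof. by elim: s => [|x s IH] /=; rewrite ?oppr0 // IH rmorphN invrN opprD. Qed.

(** The sign condition on the first two entries is kept apart, since the tails reached in the
    induction may violate it. *)
Definition admissible (s : seq int) : Prop :=
  [/\ ~~ odd (size s),
      forall i, (i < size s)%N -> `|s`_i| = if odd i then 2 else 1,
      no_three_sign_changes s & cfrac_defined s].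

Lemma admissible_opp s : admissible s -> admissible (map -%R s).
Proof.
move=> [h1 h2 h3 h4]; split; rewrite ?size_map //.
- by move=> i /h2; rewrite nth_opp normrN.
- by move=> [i]; rewrite !sign_change_opp => h; apply: h3; exists i.
- by move=> k; rewrite size_map -map_drop cfrac_opp oppr_eq0; exact: h4.
Qed.

Lemma admissible_behead2 x y s : admissible [:: x, y & s] -> admissible s.
Proof.
move=> [h1 h2 h3 h4]; split.
- by move: h1; rewrite /= negbK.
- by move=> i hi; have := h2 i.+2; rewrite /= negbK; apply.
- by move=> [i hi]; apply: h3; exists i.+2.
- by move=> k /andP[k0 hk]; have := h4 k.+2; apply.
Qed.

Lemma admissible_head x s : admissible (x :: s) ->
  exists y t, [/\ s = y :: t, x = 1 \/ x = - 1 & y = 2 \/ y = - 2].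
Proof.
case: s => [[]//|y t] [_ h _ _]; exists y, t.
have := h 0%N isT; have := h 1%N isT => /= h1 h0.
by split=> //; lia.
Qed.

(** * The reduction rules and the induction *)

Definition reduces (s : seq int) : Prop :=
  exists2 c, quotient_sum (cfrac s) c & reduced_length s = c.

(* For tails [1, 2, ...]: working with [cfrac s - 1] records that [cfrac s > 1],
   as the rules for [1, 2, -y] and [1, -2, y] require. *)
Definition reduces1 (s : seq int) : Prop :=
  exists2 c, quotient_sum (cfrac s - 1) c & reduced_length s = c.+1.

Lemma reduces1W s : reduces1 s -> reduces s.
Proof.
move=> [c h e]; exists c.+1 => //.
by have := quotient_sumD1 _ _ h; rewrite addrC subrK.
Qed.

Lemma sign_change_cons2 x y s : sign_change [:: x, y & s] 0 = (x * y < 0).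
Proof. by []. Qed.

Lemma islet_cons3 x y z s :
  islet [:: x, y, z & s] 1 = [&& `|y| == 1, x == - 2 * y & z == - 2 * y].
Proof. by []. Qed.

Lemma cfrac_cons x s : cfrac (x :: s) = x%:~R + (cfrac s)^-1.
Proof. by []. Qed.

Lemma reduces_12 s : reduces s -> 0 < s`_0 -> reduces1 [:: 1, 2 & s].
Proof.
case: s => // x s [c h e] /= x0; exists c.+2.
  have := quotient_sumV _ _ (quotient_sumD1 _ _ (quotient_sumD1 _ _
    (quotient_sumV _ _ h))).
  congr quotient_sum; rewrite [RHS]addrC (cfrac_cons 1) (cfrac_cons 2) addKr.
  by congr _^-1; rewrite addrA.
rewrite (reduced_length_cons 1) (reduced_length_cons 2) e.
rewrite !sign_change_cons2 islet_cons3.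
by case: s h e => [|y s] h e; rewrite ?islet_cons3 /=; lia.
Qed.

Lemma reduces_12N s :
  reduces1 s -> 0 < s`_0 -> 0 < s`_1 -> reduces1 [:: 1, 2 & map -%R s].
Proof.
case: s => // x [|y s] // [c h e] /= x0 y0; exists c.+2.
  (* For the value [r] of the tail, [2 - 1/r = 1 + 1/(1 + 1/(r - 1))]. *)
  have := quotient_sumV _ _ (quotient_sumD1 _ _ (quotient_sumV _ _
    (quotient_sumD1 _ _ (quotient_sumV _ _ h)))).
  have := quotient_sum_gt0 _ _ h.
  rewrite -[[:: - x, - y & _]]/(map -%R [:: x, y & s]) (cfrac_cons 1).
  rewrite (cfrac_cons 2) cfrac_opp; move: (cfrac _) => r r1.
  by congr quotient_sum; field; rewrite !neq_lt; lra.
rewrite (reduced_length_cons 1) (reduced_length_cons 2).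
rewrite -[[:: - x, - y & _]]/(map -%R [:: x, y & s]) reduced_length_opp e.
(* If [x = 1], it is [0 < y] that keeps the entry [- x] from being an islet. *)
by rewrite !sign_change_cons2 !islet_cons3 /=; lia.
Qed.

(** The four new entries have absolute sum 6 and lose 2 for the sign changes and 2 for the islet at
    [- 1], which leaves the 2 of the value [2 + r]. *)
Lemma reduces_islet s :
  reduces s -> 0 < s`_0 -> reduces1 [:: 1, 2, - 1, 2 & s].
Proof.
case: s => // x s [c h e] /= x0; exists c.+1.
  have := quotient_sumD1 _ _ h; have := quotient_sum_gt0 _ _ h.
  rewrite (cfrac_cons 1) (cfrac_cons 2) (cfrac_cons (- 1)) (cfrac_cons 2).
  move: (cfrac _) => r r1.
  by congr quotient_sum; field; rewrite !neq_lt; lra.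
rewrite (reduced_length_cons 1) (reduced_length_cons 2).
rewrite (reduced_length_cons (- 1)) (reduced_length_cons 2) e.
rewrite !sign_change_cons2 !islet_cons3.
by case: s h e => [|y s] h e; rewrite ?islet_cons3 /=; lia.
Qed.

Lemma reduces_1N2N s :
  reduces s -> 0 < s`_0 -> reduces [:: 1, - 2 & map -%R s].
Proof.
case: s => // x s [c h e] /= x0; exists c.+2.
  (* [1 - 1/(2 + 1/r) = 1/(1 + 1/(1 + 1/r))]. *)
  have := quotient_sumV _ _ (quotient_sumD1 _ _ (quotient_sumV _ _
    (quotient_sumD1 _ _ (quotient_sumV _ _ h)))).
  have := quotient_sum_gt0 _ _ h.
  rewrite -[- x :: _]/(map -%R (x :: s)) (cfrac_cons 1).
  rewrite (cfrac_cons (- 2)) cfrac_opp; move: (cfrac _) => r r1.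
  by congr quotient_sum; field; rewrite !neq_lt; lra.
rewrite (reduced_length_cons 1) (reduced_length_cons (- 2)).
rewrite -[- x :: _]/(map -%R (x :: s)) reduced_length_opp e.
rewrite !sign_change_cons2 !islet_cons3.
by case: s h e => [|y s] h e; rewrite ?islet_cons3 /=; lia.
Qed.

Lemma reduces_1N2 s :
  reduces1 s -> 0 < s`_0 -> 0 < s`_1 -> reduces [:: 1, - 2 & s].
Proof.
case: s => // x [|y s] // [c h e] /= x0 y0; exists c.+2.
  (* The value is [1/(2 + 1/(r - 1))]; the three innermost inversions amount to one. *)
  have := quotient_sumV _ _ (quotient_sumD1 _ _ (quotient_sumD1 _ _
    (quotient_sumV _ _ (quotient_sumV _ _ (quotient_sumV _ _ h))))).
  have := quotient_sum_gt0 _ _ h.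
  rewrite (cfrac_cons 1) (cfrac_cons (- 2)); move: (cfrac _) => r r1.
  by congr quotient_sum; field; rewrite !neq_lt; lra.
rewrite (reduced_length_cons 1) (reduced_length_cons (- 2)) e.
by rewrite !sign_change_cons2 !islet_cons3 /=; lia.
Qed.

Lemma reduces1_12 : reduces1 [:: 1; 2].
Proof.
exists 2%N; last by rewrite /reduced_length !big_cons big_nil.
have := quotient_sumV _ _ (quotient_sumD1 _ _ quotient_sum1).
by congr quotient_sum.
Qed.

Lemma reduces_1N2_nil : reduces [:: 1; - 2].
Proof.
exists 2%N; last by rewrite /reduced_length !big_cons big_nil.
have := quotient_sumV _ _ (quotient_sumD1 _ _ quotient_sum1).
by congr quotient_sum.
Qed.

(** A negative second entry makes the value less than 1, so [reduces1] is claimed only for a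
    positive one. In the strong induction on the size, the signs of the second to fourth entries
    select the rule. *)
Lemma reduces_admissible s : admissible s -> 0 < s`_0 ->
  if 0 < s`_1 then reduces1 s else reduces s.
Proof.
have [m] := ubnP (size s); elim: m s => // m IH [//|x s] ltm adm x0.
have IH1 t : admissible t -> (size t < size s)%N -> 0 < t`_0 -> 0 < t`_1 ->
    reduces1 t.
  move=> adm_t ht t0 t1.
  by have := IH t (ltn_trans ht ltm) adm_t t0; rewrite t1.
have IH0 t : admissible t -> (size t < size s)%N -> 0 < t`_0 -> reduces t.
  move=> adm_t ht t0; have := IH t (ltn_trans ht ltm) adm_t t0.
  by case: ifP => // _; exact: reduces1W.
have [b [t [es ex eb]]] := admissible_head _ _ adm; subst s.
have {ex} ex : x = 1 by case: ex x0 => ->.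
subst x; clear x0; have adm_t := admissible_behead2 _ _ _ adm.
have [_ _ no3 def] := adm.
case: t => [|c t] in adm adm_t no3 def ltm IH0 IH1 *.
  by case: eb => ->; [exact: reduces1_12 | exact: reduces_1N2_nil].
have [d [u [et ec ed]]] := admissible_head _ _ adm_t; subst t.
have adm_u := admissible_behead2 _ _ _ adm_t.
have adm_Nt := admissible_opp _ adm_t.
have oppK : map -%R (map -%R [:: c, d & u]) = [:: c, d & u].
  exact: mapK opprK _.
have size_Nt : (size (map -%R [:: c, d & u]) < size [:: b, c, d & u])%N.
  by rewrite size_map.
case: eb ec ed => eb [] ec [] ed; subst b c d.
- by apply: reduces_12 => //; apply: IH0.
- by apply: reduces_12 => //; apply: IH0.
(* The list starts with 1, 2, -1, 2. It cannot end there, since the tail [2, -1, 2] vanishes; a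
   negative next entry would be a third consecutive sign change. So the -1 is an islet followed by a
   positive tail. *)
- clear adm_Nt oppK size_Nt.
  case: u => [|f u] in adm adm_t adm_u no3 def ltm IH0 IH1 *.
    by have /eqP[] := def 1%N isT; rewrite /= !(invr0, addr0).
  have [g [v [eu [] ef eg]]] := admissible_head _ _ adm_u; subst f.
    by apply: reduces_islet => //; apply: IH0 => //=; lia.
  by case: no3; exists 1%N.
- by rewrite -oppK; apply: reduces_12N => //; apply: IH1.
- by apply: reduces_1N2 => //; apply: IH1.
- by case: no3; exists 0%N.
- by rewrite -oppK; apply: reduces_1N2N => //; apply: IH0.
- by rewrite -oppK; apply: reduces_1N2N => //; apply: IH0.
Qed.

Theorem proposition2p25 (n : nat) (a e : seq int) (alpha beta : int)
    (hn : (0 < n)%N)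
    (size_a : size a = (2 * n)%N)
    (size_e : size e = (2 * n)%N)
    (e_unit : forall i : nat, (i < 2 * n)%N -> e`_i = 1 \/ e`_i = - 1)
    (* 0-based: the odd positions carry the coefficient 2 *)
    (a_e : forall i : nat, (i < 2 * n)%N ->
       a`_i = if odd i then 2 * e`_i else e`_i)
    (a_defined : cfrac_defined a)
    (beta_neq0 : beta != 0)
    (alpha_beta : alpha%:~R / beta%:~R = cfrac a :> rat)
    (no_three : no_three_sign_changes a)
    (e1_e2 : e`_0 = e`_1) :
  (crossing_number (alpha%:~R / beta%:~R))%:Z =
    \sum_(i < 2 * n) `|a`_i|
    - (count (sign_change a) (iota 0 (2 * n)))%:Z
    - 2 * (count (islet a) (iota 0 (2 * n)))%:Z.
Proof.
have adm : admissible a.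
  split=> // [|i]; rewrite size_a ?oddM // => hi.
  by rewrite a_e //; case: (e_unit i hi) => ->; case: odd.
rewrite alpha_beta.
have -> : \sum_(i < 2 * n) `|a`_i| = \sum_(x <- a) `|x|.
  by rewrite (big_nth 0) big_mkord size_a.
rewrite -size_a -/(reduced_length a).
(* Equal signs at the start give a value above 1 in absolute value, so that it has a positive
   expansion. *)
have a01 : a`_1 = 2 * a`_0 by rewrite !a_e -?e1_e2 //; lia.
have main s : admissible s -> 0 < s`_0 -> 0 < s`_1 ->
    (crossing_number (cfrac s))%:Z = reduced_length s.
  move=> adm_s s0 s1; have := reduces_admissible _ adm_s s0; rewrite s1.
  case=> c h ->; congr Posz.
  have r0 := quotient_sum_gt0 _ _ h; have := quotient_sumD1 _ _ h.
  by rewrite addrC subrK; apply: crossing_number_quotient_sum; lra.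
have [a0|a0] : 0 < a`_0 \/ 0 < - a`_0.
- have lt0n : (0 < 2 * n)%N by lia.
  by rewrite a_e //; case: (e_unit _ lt0n) => ->; [left | right].
- by apply: main => //; lia.
- rewrite -crossing_numberN -cfrac_opp -reduced_length_opp.
  by apply: main; rewrite ?nth_opp //; [exact: admissible_opp | lia].
Qed.
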